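(* An invariant almost Hermitian structure $(g,J)$ on a flag manifold $\mathbb F_\Theta$ is almost Kähler if and only if it is Kähler.
   Context: Flag manifolds. $\mathfrak g$ is a finite-dimensional complex semisimple Lie algebra, $\mathfrak h$ a Cartan subalgebra, $R$ the root system, $B$ the Killing form, $H_\alpha\in\mathfrak h$ the element with $\alpha(X)=B(X,H_\alpha)$, $\mathfrak h_{\mathbb R}$ the real span of the $H_\alpha$, $\Sigma$ a simple system, $R^\pm$ the positive/negative roots. For $\Theta\subset\Sigma$: $R_\Theta=\langle\Theta\rangle\cap R$, $R_\Theta^{\pm}=R_\Theta\cap R^{\pm}$, $R_M=R\setminus R_\Theta$, $R_M^+=R_M\cap R^+$. $G$ is a Lie group with Lie algebra $\mathfrak g$, $P_\Theta$ the normalizer in $G$ of $\mathfrak p_\Theta=\mathfrak h\oplus\sum_{\alpha\in R^+}\mathfrak g_\alpha\oplus\sum_{\alpha\in R_\Theta^-}\mathfrak g_\alpha$, and $\mathbb F_\Theta=G/P_\Theta$. Fix a Weyl basis $X_\alpha\in\mathfrak g_\alpha$ ($B(X_\alpha,X_{-\alpha})=1$, $[X_\alpha,X_\beta]=n_{\alpha,\beta}X_{\alpha+\beta}$ with $n_{\alpha,\beta}$ real and nonzero iff $\alpha+\beta\in R$, $n_{\alpha,\beta}=-n_{-\alpha,-\beta}$). Put $\mathfrak u_\alpha=\mathrm{span}_{\mathbb R}\{X_\alpha-X_{-\alpha},\,i(X_\alpha+X_{-\alpha})\}$, $\mathfrak u=i\mathfrak h_{\mathbb R}\oplus\sum_{\alpha\in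 R^+}\mathfrak u_\alpha$ (a compact real form), $U\subset G$ the corresponding compact group, $K_\Theta=P_\Theta\cap U$, with Lie algebra $\mathfrak k_\Theta=i\mathfrak h_{\mathbb R}\oplus\sum_{\alpha\in R_\Theta^+}\mathfrak u_\alpha$. Then $\mathbb F_\Theta=U/K_\Theta$ with tangent space at the origin $\mathfrak m=\sum_{\alpha\in R_M^+}\mathfrak u_\alpha$. Structures. An invariant almost complex structure is (equivalent to) a linear map $J:\mathfrak m\to\mathfrak m$ with $J^2=-\mathrm{Id}$ commuting with $\mathrm{ad}(L)$ for all $L\in\mathfrak k_\Theta$. An invariant metric is (equivalent to) an $\mathrm{ad}(\mathfrak k_\Theta)$-invariant inner product $g$ on $\mathfrak m$. An invariant almost Hermitian structure is a pair $(g,J)$ of these (automatically $g(JX,JY)=g(X,Y)$). $J$ is integrable if its Nijenhuis tensor vanishes: $-\tfrac12N(X,Y)=-[JX,JY]+[X,Y]+J[X,JY]+J[JX,Y]=0$ for $X,Y\in\mathfrak m$ (brackets projected to $\mathfrak m$). Kähler form. $\Omega(X,Y)=g(X,JY)$, a $U$-invariant 2-form on $\mathbb F_\Theta$; at the origin, with brackets projected to $\mathfrak m$, $3\,d\Omega(X,Y,Z)=-\Omega([X,Y],Z)+\Omega([X,Z],Y)-\Omega([Y,Z],X)$. The structure $(g,J)$ is almost Kähler if $d\Omega=0$, and Kähler if $d\Omega=0$ and $J$ is integrable. *)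

(* Defs.v *)
From HB Require Import structures.
From mathcomp Require Import all_boot all_order all_algebra.
From mathcomp Require Import classical_sets reals complex.
Set Implicit Arguments.
Unset Strict Implicit.
Unset Printing Implicit Defensive.
Import GRing.Theory.
Local Open Scope ring_scope.
Local Open Scope complex_scope.
Local Open Scope classical_set_scope.

HB.mixin Record Vector_isLieAlgebra (K : fieldType) (L : Type)
    of Vector K L := {
  lie_br : L -> L -> L;
  lie_brDl : forall (a : K) (x y z : L),
    lie_br (a *: x + y) z = a *: lie_br x z + lie_br y z;
  lie_brDr : forall (a : K) (x y z : L),
    lie_br z (a *: x + y) = a *: lie_br z x + lie_br z y;
  lie_brxx : forall x : L, lie_br x x = 0;
  lie_jacobi : forall x y z : L,
    lie_br x (lie_br y z) + lie_br y (lie_br z x) + lie_br z (lie_br x y) = 0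
}.

#[short(type="lieAlgType")]
HB.structure Definition LieAlgebra (K : fieldType) :=
  { L of Vector_isLieAlgebra K L & Vector K L }.

Notation "[br x , y ]" := (lie_br x y)
  (at level 0, x at level 99, y at level 99, format "[br  x ,  y ]") : ring_scope.

Section LieAlgebraTheory.
Context (K : fieldType) (L : lieAlgType K).
Implicit Types (U V I h : {vspace L}) (x y : L).

Definition lie_ad x : 'End(L) := linfun (lie_br x).

Definition lie_killing x y : K :=
  \tr (passmx.mxof (vbasis {:L}) (vbasis {:L}) (lie_ad x \o lie_ad y)%VF).

Definition lie_prod U V : {vspace L} :=
  <<[seq [br x, y] | x <- vbasis U, y <- vbasis V]>>%VS.

Definition lie_ideal I := forall x y, y \in I -> [br x, y] \in I.

Definition lie_subalgebra V :=
  forall x y, x \in V -> y \in V -> [br x, y] \in V.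

Definition lie_solvable V :=
  exists n, iter n (fun W => lie_prod W W) V = 0%VS.

Definition lie_nilpotent V := exists n, iter n (lie_prod V) V = 0%VS.

Definition lie_semisimple :=
  forall I, lie_ideal I -> lie_solvable I -> I = 0%VS.

Definition cartan_subalgebra h :=
  [/\ lie_subalgebra h, lie_nilpotent h
    & forall x, (forall y, y \in h -> [br x, y] \in h) -> x \in h].

End LieAlgebraTheory.

Section Roots.
Context (K : fieldType) (L : lieAlgType K) (h : {vspace L}).
Implicit Types (a b : 'Hom(subvs_of h, K^o)).
Implicit Types (Rt Sigma Theta : seq 'Hom(subvs_of h, K^o)).

Definition in_root_space a (x : L) :=
  forall H : subvs_of h, [br vsval H, x] = (a H : K) *: x.

Definition is_root a := a != 0 /\ exists2 x, x != 0 & in_root_space a x.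

Definition root_system Rt := uniq Rt /\ forall a, a \in Rt <-> is_root a.

Definition nat_comb Sigma a :=
  exists c : 'Hom(subvs_of h, K^o) -> nat, a = \sum_(s <- Sigma) s *+ c s.

Definition simple_system Rt Sigma :=
  [/\ {subset Sigma <= Rt}, free Sigma
    & forall a, a \in Rt -> nat_comb Sigma a \/ nat_comb Sigma (- a)].

(* R_Theta^+ and R_M^+ = R^+ \ R_Theta, where R_Theta consists of the roots in
   the linear span of Theta. *)
Definition pos_root_Theta Rt Sigma Theta a :=
  [/\ a \in Rt, nat_comb Sigma a & a \in <<Theta>>%VS].

Definition pos_root_M Rt Sigma Theta a :=
  [/\ a \in Rt, nat_comb Sigma a & a \notin <<Theta>>%VS].

(* [H] is the vector H_a representing the root [a] via the Killing form. *)
Definition killing_dual a (H : L) :=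
  H \in h /\ forall Y : subvs_of h, a Y = lie_killing (vsval Y) H.

End Roots.

(* The flag manifold is U / K_Theta; invariant structures on it are given by
   their values on the tangent space m at the origin. *)

Section Flag.
Context (R : realType) (L : lieAlgType R[i]) (h : {vspace L}).
Local Notation root := 'Hom(subvs_of h, R[i]^o).
Context (Rt Sigma Theta : seq root).
Context (X : root -> L).
Implicit Types (a b : root) (J : L -> L) (g : L -> L -> R).

(* The [X a], for [a] a root, together with a basis of the Cartan subalgebra
   form a basis of the Lie algebra.  The case [a + b = 0], where the bracket
   lies in the Cartan subalgebra, is excluded from the bracket relation. *)
Record weyl_basis (n : root -> root -> R) : Prop := WeylBasis {
  weyl_root_space : forall a, a \in Rt -> in_root_space a (X a);
  weyl_basis_of : basis_of {:L}%VS (vbasis h ++ [seq X a | a <- Rt]);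
  weyl_killing : forall a, a \in Rt -> lie_killing (X a) (X (- a)) = 1;
  weyl_br : forall a b, a \in Rt -> b \in Rt -> a + b != 0 ->
    [br X a, X b] = (n a b)%:C *: X (a + b);
  weyl_n_neq0 : forall a b, a \in Rt -> b \in Rt ->
    (n a b != 0) = (a + b \in Rt);
  weyl_nN : forall a b, a \in Rt -> b \in Rt -> n a b = - n (- a) (- b)
}.

Definition real_subspace (V : set L) :=
  V 0 /\ forall (t : R) x y, V x -> V y -> V (t%:C *: x + y).

Definition rspan (A : set L) : set L := smallest real_subspace A.

Definition h_real : set L :=
  rspan [set H | exists2 a, a \in Rt & killing_dual a H].

Definition u_ a : set L :=
  rspan [set X a - X (- a); 'i *: (X a + X (- a))].

Definition k_Theta : set L :=
  rspan ([set 'i *: H | H in h_real] `|`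
         \bigcup_(a in pos_root_Theta Rt Sigma Theta) u_ a).

Definition m_ : set L :=
  rspan (\bigcup_(a in pos_root_M Rt Sigma Theta) u_ a).

(* The component in m of an element of u = k_Theta (+) m. *)
Definition pr_m (z : L) : L := xget 0 [set w | m_ w /\ k_Theta (z - w)].

Local Notation "[brm x , y ]" := (pr_m [br x, y])
  (at level 0, x at level 99, y at level 99).

(* J and g are total functions on the Lie algebra of which only the
   restrictions to m are relevant. *)
Record invariant_acs J : Prop := InvariantACS {
  acs_m : forall x, m_ x -> m_ (J x);
  acs_linear : forall (t : R) x y, m_ x -> m_ y ->
    J (t%:C *: x + y) = t%:C *: J x + J y;
  acs_sqr : forall x, m_ x -> J (J x) = - x;
  acs_inv : forall l x, k_Theta l -> m_ x -> J [br l, x] = [br l, J x]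
}.

Record invariant_metric g : Prop := InvariantMetric {
  metric_linear : forall (t : R) x y z, m_ x -> m_ y -> m_ z ->
    g (t%:C *: x + y) z = t * g x z + g y z;
  metric_sym : forall x y, m_ x -> m_ y -> g x y = g y x;
  metric_pos : forall x, m_ x -> x != 0 -> 0 < g x x;
  metric_inv : forall l x y, k_Theta l -> m_ x -> m_ y ->
    g [br l, x] y + g x [br l, y] = 0
}.

Definition invariant_almost_hermitian g J :=
  invariant_metric g /\ invariant_acs J.

Definition nijenhuis J (x y : L) : L :=
  - ((- [brm J x, J y] + [brm x, y] + J [brm x, J y] + J [brm J x, y]) *+ 2).

Definition integrable J := forall x y, m_ x -> m_ y -> nijenhuis J x y = 0.

Definition kaehler_form g J (x y : L) : R := g x (J y).

Definition d_kaehler_form g J (x y z : L) : R :=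
  3%:R^-1 * (- kaehler_form g J [brm x, y] z + kaehler_form g J [brm x, z] y
             - kaehler_form g J [brm y, z] x).

Definition almost_kaehler g J :=
  forall x y z, m_ x -> m_ y -> m_ z -> d_kaehler_form g J x y z = 0.

Definition kaehler g J := almost_kaehler g J /\ integrable J.

End Flag.

(* Main.v *)
Require Import Defs.
From HB Require Import structures.
From mathcomp Require Import all_boot all_order all_algebra.
From mathcomp Require Import classical_sets reals complex.
From mathcomp Require Import ring.
Set Implicit Arguments.
Unset Strict Implicit.
Unset Printing Implicit Defensive.
Import Order.TTheory GRing.Theory Num.Theory.
Local Open Scope ring_scope.
Local Open Scope complex_scope.
Local Open Scope classical_set_scope.

(* Extend [J] and [g] complex linearly to the span of the [X a], [a] in R_M.
   Commutation with the torus makes each root vector an eigenvector of [J], with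
   eigenvalue [e a = +-i] and [e (- a) = - e a], while [g (X (- a)) (X a)] is a
   negative real [- u a].  If the differential of the Kaehler form vanishes, its
   value on root vectors with [a + b + c = 0] gives
   [e a * u a + e b * u b + e c * u c = 0].  As [u > 0], the three eigenvalues of
   such a triple are not all equal, and this is exactly the condition for the
   Nijenhuis tensor to vanish on root vectors. *)

(** The eigenvector step carries most of the weight. Among torus elements [k_Theta] contains only
    ['i *: H] with [H] a real combination of the vectors H_a, so commutation with it sees a root b
    only through the numbers b(H_a). These numbers must separate the roots, which follows from
    semisimplicity because the common kernel of the roots in [h] is zero. They must also be real,
    since otherwise ['i *: H_a] would not preserve the real planes [u_ X b]. Reality is not part of
    the notion of a Weyl basis and has to be extracted from the real structure constants. A second
    obstacle is that [pr_m] is a choice function, while [J] and [g] are meaningful on m only. Once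
    brackets of m are known to lie in m + k_Theta, [pr_m] agrees there with a complex linear
    projection. Identities can then be moved between m and the root vectors, because m is a real
    form of their complex span. *)

Lemma mxtrace_sqr_scale (K : fieldType) (n : nat) (A : 'M[K]_n) (t : K) :
  A *m A = t *: A -> \tr A = t *+ \rank A.
Proof.
move=> AA; have AE := mulmx_base A.
(* In the rank factorization [A = C B] both factors can be cancelled from [C B C B = t C B]. This
   leaves [B C = t] in dimension [\rank A], and [A] and [B C] have the same trace. *)
suff RC : row_base A *m col_base A = t%:M.
  by rewrite -[in LHS]AE mxtrace_mulC RC mxtrace_scalar.
apply: (row_free_inj (row_base_free A)); rewrite mul_scalar_mx.
apply: (row_full_inj (col_base_full A)).
by rewrite -scalemxAr AE -AA -[in RHS]AE !mulmxA.
Qed.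

Lemma memv_linear_span (K : fieldType) (V W : vectType K) (f : V -> W)
    (s : seq V) (U : {vspace W}) : linear f ->
  (forall v, v \in s -> f v \in U) -> forall x, x \in <<s>>%VS -> f x \in U.
Proof.
move=> f_lin fU x; pose F : {linear V -> W} :=
  HB.pack f (GRing.isLinear.Build K V W _ f f_lin).
have fE y : linfun F y = f y by rewrite lfunE.
suff /subvP sU : (<<s>> <= linfun F @^-1: U)%VS.
  by move=> /sU; rewrite -memv_preim fE.
by apply/span_subvP => v /fU; rewrite -memv_preim fE.
Qed.

Lemma addNr_neq0 (V : zmodType) (a b : V) : (- a + b != 0) = (b != a).
Proof. by rewrite addrC subr_eq0. Qed.

(** * The Killing form *)

Section KillingForm.
Context (K : fieldType) (L : lieAlgType K).
Implicit Types (x y z : L) (U V W : {vspace L}).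

Lemma lie_br_is_linear x : linear (lie_br x).
Proof. by move=> a y z; rewrite lie_brDr. Qed.
HB.instance Definition _ x :=
  GRing.isLinear.Build K L L _ (lie_br x) (lie_br_is_linear x).

Lemma lie_brC x y : [br x, y] = - [br y, x].
Proof.
have := lie_brDl 1 x y (x + y).
rewrite !scale1r lie_brxx !linearD /= !lie_brxx add0r addr0.
by move=> /esym/eqP; rewrite addr_eq0 => /eqP.
Qed.

Lemma lie_brl_linear z : linear (fun x => [br x, z]).
Proof. by move=> a x y; rewrite lie_brDl. Qed.

Lemma lie_br0l z : [br 0, z] = 0.
Proof. by rewrite lie_brC linear0 oppr0. Qed.
Lemma lie_br_Dl x y z : [br x + y, z] = [br x, z] + [br y, z].
Proof. by rewrite 3!(lie_brC _ z) linearD opprD. Qed.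
Lemma lie_brNl x z : [br - x, z] = - [br x, z].
Proof. by rewrite 2!(lie_brC _ z) linearN. Qed.
Lemma lie_brZl a x z : [br a *: x, z] = a *: [br x, z].
Proof. by rewrite 2!(lie_brC _ z) linearZ scalerN. Qed.

Lemma lie_brZr a x z : [br z, a *: x] = a *: [br z, x].
Proof. exact: linearZ. Qed.
Lemma lie_brBr x y z : [br z, x - y] = [br z, x] - [br z, y].
Proof. exact: linearB. Qed.

Lemma lie_adE x y : lie_ad x y = [br x, y].
Proof. by rewrite lfunE. Qed.

Lemma lie_ad_linear : linear (@lie_ad K L).
Proof.
by move=> a x y; apply/lfunP=> z; rewrite add_lfunE scale_lfunE !lie_adE lie_brDl.
Qed.

Lemma lie_br_br x y z : [br [br x, y], z] = [br x, [br y, z]] - [br y, [br x, z]].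
Proof.
have := lie_jacobi x y z; rewrite (lie_brC z [br x, y]) => /eqP.
rewrite subr_eq0 => /eqP <-; congr (_ + _).
by rewrite (lie_brC z x) linearN.
Qed.

Definition lie_trace (f : 'End(L)) : K :=
  \tr (passmx.mxof (vbasis {:L}) (vbasis {:L}) f).

Lemma lie_trace_linear : scalar lie_trace.
Proof. by move=> a f g; rewrite /lie_trace passmx.mxof_linear linearP. Qed.

Lemma lie_traceC f g : lie_trace (f \o g)%VF = lie_trace (g \o f)%VF.
Proof.
have bL := vbasisP {:L}.
by rewrite /lie_trace !(passmx.mxof_comp _ _ bL) mxtrace_mulC.
Qed.

Lemma lie_trace_sqr_scale (f : 'End(L)) t : (f \o f)%VF = t *: f ->
  exists k : nat, lie_trace f = t *+ k.
Proof.
have bL := vbasisP {:L}; set e := vbasis {:L} in bL.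
move=> ff; exists (\rank (passmx.mxof e e f)); apply: mxtrace_sqr_scale.
rewrite -(passmx.mxof_comp _ _ bL) ff -[t *: f]addr0 passmx.mxof_linear.
have /eqP -> : passmx.mxof e e (0 : 'End(L)) == 0 by rewrite passmx.mxof_eq0.
by rewrite addr0.
Qed.

Lemma lie_killingE x y : lie_killing x y = lie_trace (lie_ad x \o lie_ad y)%VF.
Proof. by []. Qed.

Lemma lie_killingC x y : lie_killing x y = lie_killing y x.
Proof. exact: lie_traceC. Qed.

Lemma lie_killing_linear x : scalar (lie_killing x).
Proof.
move=> a y z; rewrite !lie_killingE lie_ad_linear comp_lfunDr -comp_lfunZr.
exact: lie_trace_linear.
Qed.
HB.instance Definition _ x :=
  GRing.isLinear.Build K L K _ (lie_killing x) (lie_killing_linear x).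

Lemma lie_killingDl x y z : lie_killing (x + y) z = lie_killing x z + lie_killing y z.
Proof. by rewrite 3!(lie_killingC _ z) linearD. Qed.
Lemma lie_killingNl x z : lie_killing (- x) z = - lie_killing x z.
Proof. by rewrite 2!(lie_killingC _ z) linearN. Qed.
Lemma lie_killingZl a x z : lie_killing (a *: x) z = a * lie_killing x z.
Proof. by rewrite 2!(lie_killingC _ z) linearZ. Qed.

Lemma lie_ad_br x y :
  lie_ad [br x, y] = ((lie_ad x \o lie_ad y) - (lie_ad y \o lie_ad x))%VF.
Proof.
apply/lfunP => z; rewrite add_lfunE opp_lfunE !comp_lfunE !lie_adE.
exact: lie_br_br.
Qed.

Lemma lie_killing_br x y z : lie_killing [br x, y] z = lie_killing x [br y, z].
Proof.
have trB f g : lie_trace (f - g) = lie_trace f - lie_trace g.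
  by rewrite -scaleN1r addrC lie_trace_linear addrC mulN1r.
rewrite !lie_killingE !lie_ad_br comp_lfunDl comp_lfunDr comp_lfunNl comp_lfunNr.
by rewrite !trB -!comp_lfunA; congr (_ - _); rewrite lie_traceC comp_lfunA.
Qed.

Lemma memv_lie_prod U V x y : x \in U -> y \in V -> [br x, y] \in lie_prod U V.
Proof.
move=> xU yV; have bU := span_basis (vbasisP U); have bV := span_basis (vbasisP V).
apply: (memv_linear_span (lie_brl_linear y) _ (s := vbasis U)); last by rewrite bU.
move=> u uU /=; apply: (memv_linear_span (lie_br_is_linear u) _ (s := vbasis V)).
  by move=> v vV; apply/memv_span/allpairs_f.
by rewrite bV.
Qed.

Lemma lie_prodS U U' V V' : (U <= U')%VS -> (V <= V')%VS ->
  (lie_prod U V <= lie_prod U' V')%VS.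
Proof.
move=> sU sV; apply/span_subvP => _ /allpairsP[[x y] /= [xU yV ->]].
exact: memv_lie_prod (subvP sU _ (vbasis_mem xU)) (subvP sV _ (vbasis_mem yV)).
Qed.
End KillingForm.

(** * Root space decomposition *)

Section WeylBasis.
Context (R : realType) (L : lieAlgType R[i]) (hL : lie_semisimple L).
Context (h : {vspace L}) (hh : cartan_subalgebra h).
Local Notation root := 'Hom(subvs_of h, R[i]^o).
Context (Rt : seq root) (hRt : root_system Rt).
Context (X : root -> L) (n : root -> root -> R) (hX : weyl_basis Rt X n).
Implicit Types (a b c : root) (x y z : L).

(* The root [a] as a function on the whole Lie algebra, relevant only on [h]. *)
Definition ev a x : R[i] := a (vsproj h x).

Lemma ev_linear a : scalar (ev a).
Proof. by move=> t x y; rewrite /ev vsproj_is_linear linearP. Qed.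
HB.instance Definition _ a :=
  GRing.isLinear.Build R[i] L R[i] _ (ev a) (ev_linear a).

Lemma evD a b x : ev (a + b) x = ev a x + ev b x.
Proof. by rewrite /ev add_lfunE. Qed.
Lemma evN a x : ev (- a) x = - ev a x.
Proof. by rewrite /ev opp_lfunE. Qed.
Lemma evB a b x : ev (a - b) x = ev a x - ev b x.
Proof. by rewrite evD evN. Qed.

Lemma ev_inj a b : {in h, ev a =1 ev b} -> a = b.
Proof.
move=> ab; apply/lfunP => x; rewrite -[x]vsvalK.
exact/ab/subvsP.
Qed.

Lemma br_hX a x : a \in Rt -> x \in h -> [br x, X a] = ev a x *: X a.
Proof.
by move=> aR xh; rewrite -(weyl_root_space hX aR (vsproj h x)) vsprojK.
Qed.

Lemma root_neq0 a : a \in Rt -> a != 0.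
Proof. by case/(hRt.2 a). Qed.

Lemma weyl_span (V : vectType R[i]) (f : L -> V) (U : {vspace V}) : linear f ->
  (forall x, x \in h -> f x \in U) -> (forall a, a \in Rt -> f (X a) \in U) ->
  forall x, f x \in U.
Proof.
move=> f_lin fh fX x.
apply: (memv_linear_span f_lin _ (s := vbasis h ++ [seq X a | a <- Rt])); last first.
  by rewrite (span_basis (weyl_basis_of hX)) memvf.
move=> v; rewrite mem_cat => /orP[/vbasis_mem /fh //|/mapP[a aR ->]].
exact: fX.
Qed.

Lemma weyl_eq0 (V : vectType R[i]) (f : L -> V) : linear f ->
  (forall x, x \in h -> f x = 0) -> (forall a, a \in Rt -> f (X a) = 0) ->
  forall x, f x = 0.
Proof.
move=> f_lin fh fX x; apply/eqP; rewrite -memv0.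
by apply: weyl_span => [//|y /fh ->|a /fX ->]; rewrite memv0.
Qed.

Lemma X_neq0 a : a \in Rt -> X a != 0.
Proof.
move=> aR; apply/eqP => Xa0; have := weyl_killing hX aR.
by rewrite Xa0 lie_killingC linear0 => /esym/eqP; rewrite oner_eq0.
Qed.

Lemma ev_br a x y : a \in Rt -> x \in h -> y \in h -> ev a [br x, y] = 0.
Proof.
move=> aR xh yh; have [hsub _ _] := hh.
have := lie_br_br x y (X a); rewrite !br_hX ?hsub// !linearZ/= !br_hX//.
rewrite scalerN !scalerA mulrC subrr => /eqP.
by rewrite scaler_eq0 (negPf (X_neq0 aR)) orbF => /eqP.
Qed.

Definition root_kernel : {vspace L} :=
  (h :&: \bigcap_(i < size Rt) lker (lie_ad (X Rt`_i)))%VS.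

Lemma root_kernelP x :
  reflect (x \in h /\ forall a, a \in Rt -> ev a x = 0) (x \in root_kernel).
Proof.
have kerP a : x \in h -> a \in Rt -> (x \in lker (lie_ad (X a))) = (ev a x == 0).
  move=> xh aR; rewrite memv_ker lie_adE lie_brC oppr_eq0 br_hX // scaler_eq0.
  by rewrite (negPf (X_neq0 aR)) orbF.
rewrite memv_cap; apply: (iffP andP) => -[xh evx]; split=> //.
  move=> a aR; move: evx; rewrite memvE => /subv_bigcapP.
  have ia : (index a Rt < size Rt)%N by rewrite index_mem.
  move=> /(_ (Ordinal ia) isT); rewrite -memvE /= nth_index // kerP //.
  by move=> /eqP.
rewrite memvE; apply/subv_bigcapP => i _; rewrite -memvE kerP ?mem_nth //.
by rewrite evx ?mem_nth.
Qed.

(* The vectors killed by all roots form an ideal, solvable because [h] is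
   nilpotent, hence zero by semisimplicity. *)
Lemma root_kernel0 : root_kernel = 0%VS.
Proof.
have [hsub hnil _] := hh.
have kh : (root_kernel <= h)%VS by exact: capvSl.
apply: hL => [x y yZ|].
  have /root_kernelP[yh evy] := yZ.
  apply: (weyl_span (lie_brl_linear y) _ _ x) => [z zh|a aR] /=.
    by apply/root_kernelP; split=> [|a aR]; [exact: hsub | exact: ev_br].
  by rewrite lie_brC br_hX // evy // scale0r oppr0 mem0v.
have [k hk] := hnil; exists k.
have hhS : (lie_prod h h <= h)%VS.
  apply/span_subvP => _ /allpairsP[[x y] /= [xh yh ->]].
  by apply: hsub; apply: vbasis_mem.
(* The derived series of the kernel stays below the lower central series of [h]. The first inclusion
   is carried along to bound the left factor of each product by [h]. *)
suff [_] : (iter k (fun W => lie_prod W W) root_kernel <= h)%VS /\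
    (iter k (fun W => lie_prod W W) root_kernel <= iter k (lie_prod h) h)%VS.
  by rewrite hk subv0 => /eqP.
elim: k {hk} => [|k [IH1 IH2]] //=; split; last exact: lie_prodS.
exact: subv_trans (lie_prodS IH1 IH1) hhS.
Qed.

Lemma root_sep x : x \in h -> (forall a, a \in Rt -> ev a x = 0) -> x = 0.
Proof. by move=> xh evx; apply/eqP; rewrite -memv0 -root_kernel0; apply/root_kernelP. Qed.

(** A Cartan subalgebra is only nilpotent by definition. Commutativity follows because [[br x, y]]
    acts on each root line as a commutator of scalars, so every root vanishes on it. *)
Lemma cartan_abelian x y : x \in h -> y \in h -> [br x, y] = 0.
Proof.
have [hsub _ _] := hh.
by move=> xh yh; apply: root_sep => [|a aR]; [exact: hsub | exact: ev_br].
Qed.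

Lemma ev_neq0 a : a != 0 -> exists2 x, x \in h & ev a x != 0.
Proof.
move=> a0; have [/allP aB|/allPn[x xB ax]] := boolP (all (fun x => ev a x == 0) (vbasis h)).
  case/eqP: a0; apply: ev_inj => x xh; rewrite [RHS]zero_lfunE.
  apply/eqP; rewrite -[_ == 0](memv0 (vT := R[i]^o)).
  apply: (memv_linear_span (V := L) (W := R[i]^o) (f := ev a) (s := vbasis h)).
  - exact: ev_linear.
  - by move=> v /aB /eqP ->; rewrite mem0v.
  - by rewrite (span_basis (vbasisP h)).
by exists x => //; exact: vbasis_mem xB.
Qed.
Lemma killing_hX x a : x \in h -> a \in Rt -> lie_killing x (X a) = 0.
Proof.
move=> xh aR; have [y yh ay] := ev_neq0 (root_neq0 aR).
apply: (mulfI ay); rewrite mulr0 -[LHS]linearZ /= -br_hX // -lie_killing_br.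
by rewrite cartan_abelian // lie_killingC linear0.
Qed.

(** Invariance of the Killing form multiplies the pairing by [(a + b) x] and gives zero, for an [x]
    where [a + b] does not vanish. *)
Lemma killing_XX a b : a \in Rt -> b \in Rt -> a + b != 0 ->
  lie_killing (X a) (X b) = 0.
Proof.
move=> aR bR /ev_neq0[x xh]; rewrite evD => abx.
apply: (mulfI abx); rewrite mulr0 mulrDl -lie_killingZl -[ev b x * _]linearZ /=.
rewrite -!br_hX // lie_brC lie_killingNl lie_killing_br.
by rewrite addNr.
Qed.

(** The pairing of [X a] with the vector [X (- a)] is 1 before [- a] is known to be a root. If it
    were not one, [X a] would be orthogonal to [h] and to every root vector, hence to everything. *)
Lemma root_opp a : a \in Rt -> - a \in Rt.
Proof.
move=> aR; apply/negPn/negP => NaR; have := weyl_killing hX aR.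
rewrite (weyl_eq0 (V := R[i]^o) (f := lie_killing (X a))).
- by move/esym/eqP; rewrite oner_eq0.
- exact: lie_killing_linear.
- by move=> x xh; rewrite lie_killingC killing_hX.
move=> b bR; apply: killing_XX => //; apply: contra NaR.
by rewrite addrC addr_eq0 => /eqP <-.
Qed.

Lemma root_oppE a : (- a \in Rt) = (a \in Rt).
Proof. by apply/idP/idP => /root_opp //; rewrite opprK. Qed.

(* By orthogonality of the root spaces, pairing with [X (- b)] reads off the
   coordinate along [X b]. *)
Definition rc b x : R[i] := lie_killing x (X (- b)).

Lemma rc_linear b : scalar (rc b).
Proof. by move=> t x y; rewrite /rc lie_killingDl lie_killingZl. Qed.
HB.instance Definition _ b :=
  GRing.isLinear.Build R[i] L R[i] _ (rc b) (rc_linear b).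

Lemma rc_h b x : b \in Rt -> x \in h -> rc b x = 0.
Proof. by move=> bR xh; rewrite /rc killing_hX ?root_opp. Qed.

Lemma rc_X b a : b \in Rt -> a \in Rt -> rc b (X a) = (a == b)%:R.
Proof.
move=> bR aR; have [->|ab] := eqVneq; first by rewrite /rc (weyl_killing hX bR).
by rewrite /rc killing_XX ?root_opp // subr_eq0.
Qed.

Lemma root_sum (V : lmodType R[i]) (f : root -> R[i]) (v : root -> V) a :
  a \in Rt -> (forall b, b \in Rt -> f b = (a == b)%:R) ->
  \sum_(b <- Rt) f b *: v b = v a.
Proof.
move=> aR fE; rewrite (bigD1_seq a) ?hRt.1 //= fE // eqxx scale1r.
rewrite big_seq_cond big1 ?addr0 // => b /andP[bR ba].
by rewrite fE // eq_sym (negPf ba) scale0r.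
Qed.

Definition hpart x : L := x - \sum_(b <- Rt) rc b x *: X b.

Lemma hpart_h x : hpart x \in h.
Proof.
apply: (weyl_span (f := hpart)) => [t y z|y yh|a aR].
- rewrite /hpart scalerBr scaler_sumr addrACA -opprD -big_split /=.
  congr (_ - _); apply: eq_bigr => b _.
  by rewrite linearP scalerDl scalerA.
- rewrite /hpart big_seq big1 ?subr0 // => b bR.
  by rewrite rc_h // scale0r.
by rewrite /hpart (root_sum _ aR) ?subrr ?mem0v // => b bR; rewrite rc_X.
Qed.

Lemma root_dec x : x = hpart x + \sum_(b <- Rt) rc b x *: X b.
Proof. by rewrite subrK. Qed.

(** The normalization of the Weyl basis makes this the Killing dual H_a of the root. *)
Definition Hr a : L := [br X a, X (- a)].

(** This vector has weight [a - a = 0], so it commutes with [h], and [h] is its own normalizer. *)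
Lemma Hr_h a : a \in Rt -> Hr a \in h.
Proof.
move=> aR; have [_ _ hnorm] := hh; apply: hnorm => x xh.
rewrite /Hr lie_br_br (lie_brC _ x) (lie_brC (X a) x) !br_hX ?root_opp // evN.
by rewrite scaleNr opprK linearN !linearZ /= opprK (lie_brC (X a)) scalerN addNr mem0v.
Qed.

Lemma Hr_dual a x : a \in Rt -> x \in h -> lie_killing x (Hr a) = ev a x.
Proof.
move=> aR xh; rewrite -lie_killing_br br_hX // lie_killingZl.
by rewrite (weyl_killing hX) // mulr1.
Qed.

Lemma killing_dual_Hr a : a \in Rt -> killing_dual a (Hr a).
Proof.
move=> aR; split=> [|Y]; first exact: Hr_h.
by rewrite Hr_dual ?subvsP // /ev vsvalK.
Qed.

Lemma ev_Hr_sym a b : a \in Rt -> b \in Rt -> ev a (Hr b) = ev b (Hr a).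
Proof. by move=> aR bR; rewrite -!Hr_dual ?Hr_h // lie_killingC. Qed.

(** By the symmetry [ev_Hr_sym] every root vanishes on [Hr a - Hr b], so the two duals coincide. *)
Lemma Hr_sep a b : a \in Rt -> b \in Rt ->
  (forall c, c \in Rt -> ev a (Hr c) = ev b (Hr c)) -> a = b.
Proof.
move=> aR bR ab; have Hab : Hr a - Hr b = 0.
  apply: root_sep => [|c cR]; first by rewrite rpredB ?Hr_h.
  by rewrite linearB /= ev_Hr_sym // (ev_Hr_sym cR bR) ab ?subrr.
apply: ev_inj => x xh; rewrite -!Hr_dual //.
by move/eqP: Hab; rewrite subr_eq0 => /eqP ->.
Qed.

Lemma Hr_neq0 a : a \in Rt -> exists2 c, c \in Rt & ev a (Hr c) != 0.
Proof.
move=> aR; have [/allP aB|/allPn[c cR ac]] := boolP (all (fun c => ev a (Hr c) == 0) Rt).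
  have H0 : Hr a = 0.
    by apply: root_sep => [|c cR]; [exact: Hr_h | rewrite ev_Hr_sym //; apply/eqP/aB].
  have [x xh] := ev_neq0 (root_neq0 aR).
  by rewrite -Hr_dual // H0 linear0 eqxx.
by exists c.
Qed.

Lemma rc_br_h b x y : b \in Rt -> x \in h -> rc b [br x, y] = ev b x * rc b y.
Proof.
move=> bR xh; rewrite /rc lie_brC lie_killingNl lie_killing_br br_hX ?root_opp //.
by rewrite linearZ /= evN mulNr opprK.
Qed.

(** The weight is tested on the vectors [Hr c] alone, because these are what [k_iHr] places in [k]
    up to the factor ['i]. Other root coordinates vanish by [Hr_sep], and the part in [h] by
    [Hr_neq0]. *)
Lemma root_line a x : a \in Rt ->
  (forall c, c \in Rt -> [br Hr c, x] = ev a (Hr c) *: x) -> x = rc a x *: X a.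
Proof.
move=> aR xE; have rx b : b \in Rt -> b != a -> rc b x = 0.
  move=> bR ba; apply/eqP; apply: contraNT ba => rbx; apply/eqP.
  apply: Hr_sep => // c cR; apply: (mulIf rbx).
  by rewrite -rc_br_h ?Hr_h // xE // linearZ.
have xd : x = hpart x + rc a x *: X a.
  rewrite {1}(root_dec x); congr (_ + _); rewrite (bigD1_seq a) ?hRt.1 //=.
  rewrite [X in _ + X]big_seq_cond big1 ?addr0 // => b /andP[bR ba].
  by rewrite rx // scale0r.
have [c cR ac] := Hr_neq0 aR; suff hx0 : hpart x = 0 by rewrite {1}xd hx0 add0r.
apply/eqP; have := xE c cR; rewrite {1 2}xd linearD linearZ scalerDr /=.
rewrite cartan_abelian ?Hr_h ?hpart_h // add0r br_hX ?Hr_h // !scalerA.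
rewrite [ev a _ * rc a x]mulrC => /esym/(canRL (addrK _)); rewrite subrr => /eqP.
by rewrite scaler_eq0 (negPf ac).
Qed.

(** * Roots take real values on the vectors [Hr] *)

Lemma real_complex_real (r : R) : r%:C \is Num.real.
Proof. by rewrite complex_real. Qed.

Lemma br_opp_br a b : a \in Rt -> b \in Rt -> a + b != 0 ->
  exists2 t, t \is Num.real & [br X (- a), [br X a, X b]] = t *: X b.
Proof.
move=> aR bR ab; rewrite (weyl_br hX) //.
have [abR|abR] := boolP (a + b \in Rt); last first.
  exists 0; first exact: rpred0.
  have := weyl_n_neq0 hX aR bR; rewrite (negPf abR) => /negbFE/eqP ->.
  by rewrite !scale0r linear0.
exists ((n a b)%:C * (n (- a) (a + b))%:C); first by rewrite rpredM ?real_complex_real.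
rewrite linearZ /= (weyl_br hX) ?root_opp ?addKr ?root_neq0 //.
by rewrite scalerA.
Qed.

Lemma X_inj a : a \in Rt -> injective (fun t : R[i] => t *: X a).
Proof.
move=> aR s t /= /(congr1 (rc a)); rewrite !linearZ /= rc_X // eqxx.
by rewrite !mulr1.
Qed.

(* For [b <> +-a] the value [b (H_a)] is a difference of products of structure
   constants, by the Jacobi identity applied to [[X a, X (- a)], X b]. *)
Lemma ev_Hr_real_neq a b : a \in Rt -> b \in Rt -> b != a -> b != - a ->
  ev b (Hr a) \is Num.real.
Proof.
move=> aR bR ba bNa.
have [t tR tE] : exists2 t, t \is Num.real & [br X (- a), [br X a, X b]] = t *: X b.
  by apply: (br_opp_br aR bR); rewrite addrC addr_eq0 bNa.
have [u uR] : exists2 u, u \is Num.real &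
    [br X (- - a), [br X (- a), X b]] = u *: X b.
  by apply: (br_opp_br (root_opp aR) bR); rewrite addNr_neq0 ba.
rewrite opprK => uE; suff -> : ev b (Hr a) = u - t by rewrite rpredB.
apply: (X_inj bR); rewrite -br_hX ?Hr_h // lie_br_br tE uE.
by rewrite scalerBl.
Qed.

(* If [b - a] is a root for some root [b <> +-a], write [a] as [b / 2] or as
   [b - (b - a)] and use the previous lemma.  Otherwise
   [f = ad (X a) ad (X (- a))] satisfies [f ^ 2 = a (H_a) f] and has trace [1],
   so [a (H_a)] is the inverse of its rank. *)
Lemma ev_Hr_real_self a : a \in Rt -> ev a (Hr a) \is Num.real.
Proof.
move=> aR; have NaR := root_opp aR; set t := ev a (Hr a).
have [/hasP[b bR /and3P[ba bNa bBaR]]|/hasPn isol] :=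
  boolP (has (fun b => [&& b != a, b != - a & b - a \in Rt]) Rt).
  have tb := ev_Hr_real_neq aR bR ba bNa.
  have [bE|bBa] := eqVneq (b - a) a.
    have bE' : ev b (Hr a) = t + t by rewrite -evD -[X in X + _]bE subrK.
    have -> : t = ev b (Hr a) / 2 by rewrite bE'; field.
    by rewrite rpred_div // rpred_nat.
  have -> : t = ev b (Hr a) - ev (b - a) (Hr a) by rewrite evB opprB addrC subrK.
  rewrite rpredB // (ev_Hr_real_neq aR bBaR bBa) // subr_eq addNr.
  exact: root_neq0.
(* In the remaining case [f] kills every [X b] with [b != a]. Its image lies in the span of [Hr a]
   and [X a], and it acts on both as multiplication by [t]. *)
pose f := (lie_ad (X a) \o lie_ad (X (- a)))%VF.
have fE x : f x = [br X a, [br X (- a), x]] by rewrite comp_lfunE !lie_adE.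
have fh x : x \in h -> f x = ev a x *: Hr a.
  by move=> xh; rewrite fE (lie_brC _ x) br_hX // evN scaleNr opprK linearZ.
have fXb b : b \in Rt -> b != a -> f (X b) = 0.
  move=> bR ba; rewrite fE; have [->|bNa] := eqVneq b (- a).
    by rewrite lie_brxx linear0.
  have nba : - a + b != 0 by rewrite addNr_neq0 ba.
  rewrite (weyl_br hX) //; have := weyl_n_neq0 hX NaR bR.
  have /negPf := isol b bR; rewrite ba bNa /= addrC => -> /negbFE/eqP ->.
  by rewrite scale0r linear0.
have fXa : f (X a) = t *: X a.
  by rewrite fE (lie_brC _ (X a)) linearN -/(Hr a) -lie_brC br_hX ?Hr_h.
have ff : (f \o f)%VF = t *: f.
  apply/lfunP => x; rewrite comp_lfunE scale_lfunE; apply/eqP; rewrite -subr_eq0; apply/eqP.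
  pose F := fun x => f (f x) - t *: f x; rewrite -/(F x).
  apply: weyl_eq0 => [s y z|y yh|b bR]; rewrite /F.
  - by rewrite !linearP /= scalerBr addrACA scalerN.
  - rewrite (fh y) // linearZ /= fh ?Hr_h //.
    by rewrite !scalerA mulrC subrr.
  have [->|ba] := eqVneq b a; first by rewrite fXa linearZ /= fXa subrr.
  by rewrite fXb // linear0 scaler0 subrr.
have [k] := lie_trace_sqr_scale ff.
rewrite /f -lie_killingE (weyl_killing hX aR) -mulr_natr => tk.
have k0 : (k%:R : R[i]) != 0.
  by apply/eqP => k0; move: tk; rewrite k0 mulr0 => /eqP; rewrite oner_eq0.
suff -> : t = k%:R^-1 by rewrite rpredV rpred_nat.
by apply: (mulIf k0); rewrite -tk mulVf.
Qed.

Lemma ev_Hr_real a b : a \in Rt -> b \in Rt -> ev a (Hr b) \is Num.real.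
Proof.
move=> aR bR; have [->|ab] := eqVneq a b; first exact: ev_Hr_real_self.
have [->|aNb] := eqVneq a (- b); last exact: ev_Hr_real_neq.
by rewrite evN rpredN ev_Hr_real_self.
Qed.

(** * The tangent space of the flag manifold *)

Context (Sigma Theta : seq root) (hSigma : simple_system Rt Sigma).
Local Notation m := (m_ Rt Sigma Theta X).
Local Notation k := (k_Theta Rt Sigma Theta X).
Local Notation pr := (pr_m Rt Sigma Theta X).
Implicit Types (V : set L) (t : R[i]).

Lemma rspan_real_subspace (A : set L) : real_subspace (rspan A).
Proof.
split=> [B [[B0 _] _] //|t x y xA yA B BA].
by case: (BA) => -[_ Blin] _; apply: Blin; [exact: xA | exact: yA].
Qed.

Lemma sub_rspan (A : set L) : A `<=` rspan A.
Proof. exact: sub_gen_smallest. Qed.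

Lemma rspan_sub (A V : set L) : real_subspace V -> A `<=` V -> rspan A `<=` V.
Proof. exact: smallest_sub. Qed.

Lemma real_subspaceZ V (r : R) x : real_subspace V -> V x -> V (r%:C *: x).
Proof. by move=> [V0 Vlin] Vx; rewrite -[_ *: x]addr0; exact: Vlin. Qed.

Lemma real_subspaceD V x y : real_subspace V -> V x -> V y -> V (x + y).
Proof. by move=> [V0 Vlin] Vx Vy; rewrite -[x]scale1r; exact: Vlin. Qed.

Lemma real_subspaceN V x : real_subspace V -> V x -> V (- x).
Proof.
move=> Vs Vx; have -> : - x = (-1)%:C *: x by rewrite rmorphN scaleNr scale1r.
exact: real_subspaceZ.
Qed.

(** One complex parameter describes [u_ X a]: the values 1 and ['i] give its two generators. The
    vector is the sum of [t *: X a] and its image under the conjugation sending [X a] to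
    [- X (- a)]. *)
Definition rv a t : L := t *: X a - t^* *: X (- a).

Lemma rvN a t : rv (- a) t = rv a (- t^*).
Proof. by rewrite /rv opprK rmorphN /= conjCK !scaleNr opprK addrC. Qed.

Lemma rv_add a s t : rv a (s + t) = rv a s + rv a t.
Proof. by rewrite /rv rmorphD /= !scalerDl opprD addrACA. Qed.

Lemma rv_scale a (r : R) t : rv a (r%:C * t) = r%:C *: rv a t.
Proof. by rewrite /rv rmorphM /= (conj_Creal (real_complex_real r)) scalerBr !scalerA. Qed.

Lemma rv_split a t : 
  rv a t = (complex.Re t)%:C *: rv a 1 + (complex.Im t)%:C *: rv a 'i.
Proof.
by rewrite -!rv_scale -rv_add mulr1 complexRe complexIm {1}[t]Crect ['i * _]mulrC.
Qed.

Lemma rc_XX a b s t : a \in Rt -> b \in Rt ->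
  rc b (s *: X a - t *: X (- a)) = s * (a == b)%:R - t * (a == - b)%:R.
Proof.
move=> aR bR; have <- : (- a == b) = (a == - b) by exact: eqr_oppLR.
by rewrite linearB; congr (_ - _); rewrite linearZ /= rc_X ?root_opp.
Qed.

Lemma u_rv a t : u_ X a (rv a t).
Proof.
have us : real_subspace (u_ X a) by exact: rspan_real_subspace.
rewrite rv_split; apply: (real_subspaceD us); apply: (real_subspaceZ _ us).
  by apply: sub_rspan; left; rewrite /rv conjC1 !scale1r.
apply: sub_rspan; right => /=; rewrite /rv scalerDr.
by rewrite conjCi scaleNr opprK.
Qed.

Lemma u_sub V a : real_subspace V -> (forall t, V (rv a t)) -> u_ X a `<=` V.
Proof.
move=> Vs Va; apply: rspan_sub => // _ [->|->].
  by have := Va 1; rewrite /rv conjC1 !scale1r.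
by have := Va 'i; rewrite /rv scalerDr conjCi scaleNr opprK.
Qed.

Definition RM : seq root := [seq a <- Rt | a \notin <<Theta>>%VS].

Lemma RM_root a : a \in RM -> a \in Rt.
Proof. by rewrite mem_filter => /andP[]. Qed.

Lemma RM_opp a : a \in RM -> - a \in RM.
Proof. by rewrite !mem_filter rpredN root_oppE. Qed.

Lemma m_sub V : real_subspace V -> (forall a t, a \in RM -> V (rv a t)) -> m `<=` V.
Proof.
move=> Vs VR; apply: rspan_sub => // x [a [aR _ aT]] xu.
apply: u_sub xu => // t; apply: VR.
by rewrite mem_filter aT aR.
Qed.

Lemma m_rv a t : a \in RM -> m (rv a t).
Proof.
have pos b s : b \in RM -> nat_comb Sigma b -> m (rv b s).
  rewrite mem_filter => /andP[bT bR] bp.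
  by apply: sub_rspan; exists b; [split | exact: u_rv].
move=> aM; have [_ _ /(_ a (RM_root aM))[ap|an]] := hSigma; first exact: pos.
by rewrite -[a]opprK rvN; apply: pos => //; exact: RM_opp.
Qed.

Lemma k_rv a t : a \in Rt -> a \notin RM -> k (rv a t).
Proof.
have pos b s : b \in Rt -> b \in <<Theta>>%VS -> nat_comb Sigma b -> k (rv b s).
  move=> bR bT bp; apply: sub_rspan; right.
  by exists b; [split | exact: u_rv].
move=> aR; rewrite mem_filter aR andbT negbK => aT.
have [_ _ /(_ a aR)[ap|an]] := hSigma; first exact: pos.
by rewrite -[a]opprK rvN; apply: pos; rewrite ?root_opp ?rpredN.
Qed.

Lemma k_iHr a : a \in Rt -> k ('i *: Hr a).
Proof.
move=> aR; apply: sub_rspan; left; exists (Hr a) => //.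
by apply: sub_rspan; exists a => //; exact: killing_dual_Hr.
Qed.

Lemma k_sub V : real_subspace V -> (forall x, x \in h -> V x) ->
  (forall a t, a \in Rt -> a \notin RM -> V (rv a t)) -> k `<=` V.
Proof.
move=> Vs Vh VR; apply: rspan_sub => // x [[H Hh <-]|[a [aR _ aT] xu]].
  apply: Vh; rewrite rpredZ //; move: H Hh.
  apply: (rspan_sub (V := [set H | H \in h])) => [|H [a aR [Hh _]] //].
  by split=> [|r y z yh zh] /=; rewrite ?mem0v // memvD ?memvZ.
by apply: u_sub xu => // t; apply: VR => //; rewrite mem_filter aT.
Qed.

(** * Diagonal operators and complexification of m *)

(** Constant weight 1 gives the projection along [h] and the root spaces of R_Theta. The eigenvalues
    of [J] as weights give its complex linear extension. *)
Definition diag (d : root -> R[i]) x : L := \sum_(b <- RM) (d b * rc b x) *: X b.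

Lemma diag_linear d : linear (diag d).
Proof.
move=> t x y; rewrite /diag scaler_sumr -big_split /=; apply: eq_bigr => b _.
by rewrite linearP mulrDr scalerDl scalerA mulrCA.
Qed.
HB.instance Definition _ d :=
  GRing.isLinear.Build R[i] L L _ (diag d) (diag_linear d).

Lemma diagZ d t x : diag d (t *: x) = t *: diag d x.
Proof. exact: linearZ. Qed.

Lemma diag_h d x : x \in h -> diag d x = 0.
Proof.
move=> xh; rewrite /diag big_seq big1 // => b /RM_root bR.
by rewrite rc_h // mulr0 scale0r.
Qed.

Lemma diag_notin d a : a \in Rt -> a \notin RM -> diag d (X a) = 0.
Proof.
move=> aR aM; rewrite /diag big_seq big1 // => b bM.
have ab : a != b by apply: contraNneq aM => ->.
by rewrite (rc_X (RM_root bM) aR) (negPf ab) mulr0 scale0r.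
Qed.

Lemma diag_X d a : a \in RM -> diag d (X a) = d a *: X a.
Proof.
move=> aM; rewrite /diag (bigD1_seq a) ?filter_uniq ?hRt.1 //=.
rewrite rc_X ?RM_root // eqxx mulr1 big_seq_cond big1 ?addr0 // => b /andP[bM ba].
by rewrite rc_X ?RM_root // eq_sym (negPf ba) mulr0 scale0r.
Qed.

Lemma m_linear_eq0 (W : lmodType R[i]) (f : L -> W) : linear f ->
  (forall a, a \in RM -> f (X a) = 0) -> forall x, m x -> f x = 0.
Proof.
move=> f_lin fX; pose F : {linear L -> W} :=
  HB.pack f (GRing.isLinear.Build R[i] L W _ f f_lin).
apply: m_sub => [|a t aM] /=.
  split; first by rewrite -[f]/(F : _ -> _) linear0.
  by move=> r x y fx fy; rewrite f_lin fx fy scaler0 addr0.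
by rewrite -[f]/(F : _ -> _) /rv linearB !linearZ /= !fX ?RM_opp // ?oppr0 !scaler0 addr0.
Qed.

(** Together with [m_linear_eq0] this says that m is a real form: a complex linear identity holds on
    m exactly when it holds on the root vectors of R_M. *)
Lemma m_linear_X_eq0 (W : lmodType R[i]) (f : L -> W) : linear f ->
  (forall x, m x -> f x = 0) -> forall a, a \in RM -> f (X a) = 0.
Proof.
move=> f_lin fm a aM; pose F : {linear L -> W} :=
  HB.pack f (GRing.isLinear.Build R[i] L W _ f f_lin).
have XE : rv a 1 - 'i *: rv a 'i = 2 *: X a.
  rewrite /rv conjC1 conjCi !scale1r scaleNr opprK scalerDr !scalerA -expr2 sqrCi.
  rewrite !scaleN1r opprD !opprK addrACA [- _ + _]addrC subrr addr0.
  by rewrite -mulr2n scaler_nat.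
have : F (2 *: X a) = 0.
  have Fm x : m x -> F x = 0 by exact: fm.
  have FE x y : F (x - 'i *: y) = F x - 'i *: F y by rewrite linearB linearZ.
  by rewrite -XE FE !Fm ?scaler0 ?subr0 //; exact: m_rv.
by rewrite linearZ => /eqP; rewrite scaler_eq0 pnatr_eq0 /= => /eqP.
Qed.

Lemma m_real_subspace : real_subspace m. Proof. exact: rspan_real_subspace. Qed.
Lemma k_real_subspace : real_subspace k. Proof. exact: rspan_real_subspace. Qed.

(** * Brackets of m and the projection to m *)

Definition mk : set L := [set z | exists w, m w /\ k (z - w)].

Lemma mk_real_subspace : real_subspace mk.
Proof.
split=> [|r x y [w [mw kw]] [v [mv kv]]].
  by exists 0; rewrite subr0; split; [exact: m_real_subspace.1 | exact: k_real_subspace.1].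
exists (r%:C *: w + v); split; first by apply: m_real_subspace.2.
by rewrite opprD addrACA -scalerBr; apply: k_real_subspace.2.
Qed.

Lemma mk_k x : k x -> mk x.
Proof. by move=> kx; exists 0; rewrite subr0; split=> //; exact: m_real_subspace.1. Qed.

Lemma mk_rv a t : a \in Rt -> mk (rv a t).
Proof.
move=> aR; have [aM|aM] := boolP (a \in RM); last by apply: mk_k; exact: k_rv.
by exists (rv a t); rewrite subrr; split; [exact: m_rv | exact: k_real_subspace.1].
Qed.

(** The sum is fixed by the conjugation [X a] to [- X (- a)], compatible with brackets thanks to
    [weyl_nN]. It is an imaginary multiple of [Hr a] if [a + b = 0], and otherwise some
    [rv (a + b) s] or zero. *)
Lemma mk_br_X a b t : a \in Rt -> b \in Rt ->
  mk (t *: [br X a, X b] + t^* *: [br X (- a), X (- b)]).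
Proof.
move=> aR bR; have [ab|ab] := eqVneq (a + b) 0.
  have {ab} -> : b = - a by apply/eqP; rewrite -addr_eq0 addrC ab.
  rewrite opprK (lie_brC (X (- a))) scalerN -scalerBl -/(Hr a).
  have -> : t - t^* = (2 * complex.Im t)%:C * 'i.
    rewrite rmorphM rmorph_nat /= complexIm {1 2}[t]Crect rmorphD rmorphM /= conjCi.
    by rewrite !conj_Creal ?Creal_Re ?Creal_Im //; ring.
  rewrite -scalerA; apply: (real_subspaceZ _ mk_real_subspace).
  by apply: mk_k; exact: k_iHr.
rewrite !(weyl_br hX) ?root_opp //; last by rewrite -opprD oppr_eq0.
have [abR|abR] := boolP (a + b \in Rt); last first.
  have := weyl_n_neq0 hX aR bR; rewrite (negPf abR) => /negbFE/eqP nab.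
  have := weyl_nN hX aR bR; rewrite nab => /esym/eqP; rewrite oppr_eq0 => /eqP ->.
  by rewrite !scale0r !scaler0 addr0; exact: mk_real_subspace.1.
have -> : t *: ((n a b)%:C *: X (a + b)) + t^* *: ((n (- a) (- b))%:C *: X (- a - b)) =
    rv (a + b) (t * (n a b)%:C).
  rewrite /rv rmorphM /= (conj_Creal (real_complex_real _)) !scalerA -opprD.
  by rewrite (weyl_nN hX aR bR) rmorphN /= !mulrN !scaleNr opprK.
exact: mk_rv.
Qed.

Lemma rv_br a b s t : [br rv a s, rv b t] =
  ((s * t) *: [br X a, X b] + (s * t)^* *: [br X (- a), X (- b)])
  - ((s * t^*) *: [br X a, X (- b)] + (s * t^*)^* *: [br X (- a), X (- - b)]).
Proof.
rewrite {1}/rv lie_br_Dl lie_brNl !lie_brZl /rv !lie_brBr !lie_brZr.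
rewrite !rmorphM /= conjCK opprK !scalerBr !scalerA.
by rewrite opprB addrACA opprD.
Qed.

Lemma m_br x y : m x -> m y -> mk [br x, y].
Proof.
have mkS := mk_real_subspace.
move=> mx; move: y; move: x mx; apply: m_sub => [|a s aM].
  split=> [y _|r x y Vx Vy z mz]; first by rewrite lie_br0l; exact: mkS.1.
  by rewrite lie_brDl; apply: mkS.2; [exact: Vx | exact: Vy].
apply: m_sub => [|b t bM].
  split=> [|r x y Vx Vy]; first by rewrite linear0; exact: mkS.1.
  by rewrite lie_brDr; apply: mkS.2.
have [aR bR] := (RM_root aM, RM_root bM).
rewrite rv_br; apply: (real_subspaceD mkS); first exact: mk_br_X.
by apply: (real_subspaceN mkS); apply: mk_br_X; rewrite ?root_opp.
Qed.

Definition prM : L -> L := diag (fun=> 1).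

Lemma prM_linear : linear prM.
Proof. exact: diag_linear. Qed.
HB.instance Definition _ :=
  GRing.isLinear.Build R[i] L L _ prM prM_linear.

Lemma prM_m x : m x -> prM x = x.
Proof.
move=> mx; apply/eqP; rewrite -subr_eq0; apply/eqP.
apply: (m_linear_eq0 (f := fun x => prM x - x)) mx => [t y z|a aM] /=.
  by rewrite prM_linear scalerBr opprD addrACA.
by rewrite /prM diag_X // scale1r subrr.
Qed.

Lemma diag_k d x : k x -> diag d x = 0.
Proof.
apply: (k_sub (V := [set x | diag d x = 0])) => [|y|a t aR aM] /=.
- split=> [|r y z /= y0 z0] /=; first exact: linear0.
  by rewrite diag_linear y0 z0 scaler0 addr0.
- exact: diag_h.
have NaM : - a \notin RM by apply: contra aM => /RM_opp; rewrite opprK.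
by rewrite /rv linearB !linearZ /= !diag_notin ?root_opp // ?oppr0 !scaler0 addr0.
Qed.

(** Whatever witness the choice operator returns, it differs from [z] by an element of [k], which
    [prM] kills, and [prM] fixes m. *)
Lemma prE z : mk z -> m (pr z) /\ pr z = prM z.
Proof.
move=> mkz; have [] : m (pr z) /\ k (z - pr z) by exact: xgetPex mkz.
move=> mw kw; split=> //; rewrite -[LHS](prM_m mw).
apply/eqP; rewrite eq_sym -subr_eq0 -linearB; apply/eqP.
exact: diag_k.
Qed.

(** Vectors of m are fixed by the conjugation sending [X b] to [- X (- b)]. *)
Lemma rc_m_conj b x : b \in Rt -> m x -> rc (- b) x = - (rc b x)^*.
Proof.
move=> bR; move: x; apply: m_sub => [|a t aM].
  split=> [|r x y /= xE yE]; first by rewrite !linear0 rmorph0 oppr0.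
  rewrite !linearP /= xE yE rmorphD rmorphM /= (conj_Creal (real_complex_real _)).
  by rewrite mulrN opprD.
have aR := RM_root aM; rewrite /rv !rc_XX ?root_opp //.
by rewrite opprK rmorphB !rmorphM /= conjCK !rmorph_nat opprB.
Qed.

Lemma m_sub1i V : real_subspace V -> (forall a, a \in RM -> V (rv a 1)) ->
  (forall a, a \in RM -> V (rv a 'i)) -> m `<=` V.
Proof.
move=> VS V1 Vi; apply: m_sub => // a t aM; rewrite rv_split.
by apply: VS.2; [exact: V1 | apply: (real_subspaceZ _ VS); exact: Vi].
Qed.

Lemma m_scalar_X_eq0 (f : L -> R[i]) : scalar f ->
  (forall x, m x -> f x = 0) -> forall a, a \in RM -> f (X a) = 0.
Proof. exact: (m_linear_X_eq0 (W := R[i]^o)). Qed.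

Lemma rvN1 a : rv (- a) 1 = - rv a 1.
Proof.
rewrite rvN conjC1; have -> : -1 = (-1)%:C * 1 :> R[i] by rewrite rmorphN mulr1.
by rewrite rv_scale rmorphN scaleN1r.
Qed.

Lemma rvNi a : rv (- a) 'i = rv a 'i.
Proof. by rewrite rvN conjCi opprK. Qed.

(** Reality of [ev a (Hr c)] makes the factors on [X a] and [X (- a)] conjugate, so that the bracket
    is again of the form [rv a]. *)
Lemma br_iHr a c t : a \in Rt -> c \in Rt ->
  [br 'i *: Hr c, rv a t] = rv a ('i * ev a (Hr c) * t).
Proof.
move=> aR cR; rewrite lie_brZl /rv lie_brBr !lie_brZr !br_hX ?Hr_h ?root_opp //.
rewrite !rmorphM /= conjCi (conj_Creal (ev_Hr_real aR cR)) evN scalerBr !scalerA.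
by congr (_ *: _ - _ *: _); ring.
Qed.

Lemma br_iHr_1 a c (r : R) : a \in Rt -> c \in Rt -> ev a (Hr c) = r%:C ->
  [br 'i *: Hr c, rv a 1] = r%:C *: rv a 'i.
Proof. by move=> aR cR rE; rewrite br_iHr // rE mulr1 mulrC rv_scale. Qed.

Lemma br_iHr_i a c (r : R) : a \in Rt -> c \in Rt -> ev a (Hr c) = r%:C ->
  [br 'i *: Hr c, rv a 'i] = (- r)%:C *: rv a 1.
Proof.
move=> aR cR rE; rewrite br_iHr // rE -rv_scale; congr rv.
by rewrite rmorphN mulrAC -expr2 sqrCi mulr1 mulN1r.
Qed.

(** * Invariant almost complex and almost Hermitian structures *)

Section AlmostComplex.
Context (J : L -> L) (hJ : invariant_acs Rt Sigma Theta X J).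

Lemma acs_0 : J 0 = 0.
Proof.
have m0 := m_real_subspace.1; have := acs_linear hJ 1 m0 m0.
by rewrite rmorph1 !scale1r addr0 => /esym/eqP; rewrite -subr_eq0 addrK => /eqP.
Qed.

Lemma acs_Z r x : m x -> J (r%:C *: x) = r%:C *: J x.
Proof.
by move=> mx; have := acs_linear hJ r mx m_real_subspace.1; rewrite addr0 acs_0 addr0.
Qed.

Lemma acs_N x : m x -> J (- x) = - J x.
Proof. by move=> mx; have := acs_Z (- 1) mx; rewrite rmorphN rmorph1 !scaleN1r. Qed.

(* [acs_vect a] is the complexification of [J] applied to
   [X a = (rv a 1 - 'i rv a 'i) / 2]. *)
Definition acs_vect a : L := 2^-1 *: (J (rv a 1) - 'i *: J (rv a 'i)).

Definition acs_eig a : R[i] := rc a (acs_vect a).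

Lemma acs_vectE a : a \in RM -> acs_vect a = acs_eig a *: X a.
Proof.
move=> aM; have aR := RM_root aM; apply: root_line => // c cR.
have [r rE] := complex_realP _ (ev_Hr_real aR cR).
(* Only ['i *: Hr c] lies in [k], hence the factor ['i]. [E1] and [Ei] together say that
   [acs_vect a] has weight [a]. *)
have E1 : 'i *: [br Hr c, J (rv a 1)] = r%:C *: J (rv a 'i).
  rewrite -lie_brZl -(acs_inv hJ (k_iHr cR) (m_rv 1 aM)) (br_iHr_1 _ _ rE) //.
  by rewrite acs_Z //; exact: m_rv.
have Ei : 'i *: [br Hr c, J (rv a 'i)] = - (r%:C *: J (rv a 1)).
  rewrite -lie_brZl -(acs_inv hJ (k_iHr cR) (m_rv 'i aM)) (br_iHr_i _ _ rE) //.
  by rewrite acs_Z ?rmorphN ?scaleNr //; exact: m_rv.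
rewrite /acs_vect rE lie_brZr lie_brBr lie_brZr Ei opprK.
rewrite [RHS]scalerA [_ * 2^-1]mulrC -scalerA; congr (_ *: _).
apply: (scalerI (neq0Ci _)); rewrite scalerDr E1 [in RHS]scalerBr [in RHS]scalerBr.
rewrite !scalerA [_ * 'i]mulrAC -expr2 sqrCi mulN1r scaleNr opprK.
by rewrite addrC.
Qed.

Definition acs_diag : L -> L := diag acs_eig.

Lemma acs_diag_linear : linear acs_diag.
Proof. exact: diag_linear. Qed.

Lemma acs_vectN a : a \in RM ->
  acs_vect (- a) = - (2^-1 *: (J (rv a 1) + 'i *: J (rv a 'i))).
Proof.
move=> aM; rewrite /acs_vect rvN1 rvNi acs_N; last exact: m_rv.
by rewrite -opprD scalerN.
Qed.

Lemma acs_diag_rv a t : a \in RM ->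
  acs_diag (rv a t) = t *: acs_vect a - t^* *: acs_vect (- a).
Proof.
move=> aM; rewrite !acs_vectE ?RM_opp // /acs_diag /rv linearB; congr (_ - _).
  by rewrite linearZ /= diag_X.
by rewrite linearZ /= diag_X ?RM_opp.
Qed.

Lemma acs_diagE x : m x -> J x = acs_diag x.
Proof.
suff mV : m `<=` [set x | m x /\ J x = acs_diag x] by move=> /mV[].
have half (u : L) : 2^-1 *: (u + u) = u.
  have n2 : (2 : R[i]) != 0 by rewrite pnatr_eq0.
  by apply: (scalerI n2); rewrite scalerA mulfV // scale1r scaler_nat mulr2n.
apply: m_sub1i => [|a aM|a aM] /=.
- split=> [|r y z [my yE] [mz zE]] /=.
    by split; [exact: m_real_subspace.1 | rewrite acs_0 /acs_diag linear0].
  split; first exact: m_real_subspace.2.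
  by rewrite acs_diag_linear -yE -zE; exact: (acs_linear hJ).
- split; first exact: m_rv.
  rewrite acs_diag_rv // conjC1 !scale1r acs_vectN // opprK -scalerDr.
  by rewrite addrACA addNr addr0 half.
split; first exact: m_rv.
rewrite acs_diag_rv // conjCi scaleNr opprK -scalerDr acs_vectN //.
rewrite -scalerBr opprD addrACA subrr add0r -opprD -scalerDr 2!scalerN !scalerA.
by rewrite [_ * 'i]mulrAC -expr2 sqrCi mulN1r scaleNr opprK half.
Qed.

Lemma acs_eig_sqr a : a \in RM -> acs_eig a ^+ 2 = -1.
Proof.
move=> aM; apply: (X_inj (RM_root aM)); rewrite scaleN1r.
have : acs_diag (acs_diag (X a)) + X a = 0.
  apply: (m_linear_X_eq0 (f := fun x => acs_diag (acs_diag x) + x)) aM => [t x y|x mx].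
    by rewrite !acs_diag_linear scalerDr addrACA.
  have mJ : m (J x) by exact: (acs_m hJ).
  by rewrite -(acs_diagE mx) -acs_diagE // (acs_sqr hJ) // addNr.
rewrite /acs_diag diag_X // diagZ diag_X // scalerA -expr2 => /eqP.
by rewrite addr_eq0 => /eqP.
Qed.

(** Since [J] preserves the real form m, the eigenvalue at [- a] is the conjugate of the one at [a],
    and both are ['i] or [- 'i]. *)
Lemma acs_eig_opp a : a \in RM -> acs_eig (- a) = - acs_eig a.
Proof.
move=> aM; have aR := RM_root aM; have NaM := RM_opp aM.
have mJ : m (J (rv a 1)) by apply: (acs_m hJ); exact: m_rv.
have := rc_m_conj aR mJ; rewrite acs_diagE; last exact: m_rv.
have a0 : (a == - a) = false.
  apply/negbTE; rewrite -subr_eq0 opprK -mulr2n -scaler_nat scaler_eq0.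
  by rewrite pnatr_eq0 (negPf (root_neq0 aR)).
rewrite acs_diag_rv // conjC1 !scale1r !acs_vectE // !rc_XX ?root_opp //.
rewrite opprK eqxx a0 !mulr1 !mulr0 subr0 sub0r => /oppr_inj ->.
have /orP[/eqP ->|/eqP ->] : (acs_eig a == 'i) || (acs_eig a == - 'i).
- by rewrite -eqf_sqr sqrCi acs_eig_sqr.
- exact: conjCi.
by rewrite rmorphN /= conjCi.
Qed.

(** * The complex bilinear extension of the metric *)

Section AlmostHermitian.
Context (g : L -> L -> R) (hg : invariant_metric Rt Sigma Theta X g).

Lemma metric_Zl (r : R) x z : m x -> m z -> g (r%:C *: x) z = r * g x z.
Proof.
move=> mx mz; have m0 := m_real_subspace.1; have mlin := metric_linear hg.
have g0 : g 0 z = 0.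
  have := mlin 1 _ _ _ m0 m0 mz.
  by rewrite rmorph1 scale1r addr0 mul1r => /esym/eqP; rewrite -subr_eq0 addrK => /eqP.
by have := mlin r _ _ _ mx m0 mz; rewrite addr0 g0 addr0.
Qed.

Lemma metric_0l z : m z -> g 0 z = 0.
Proof.
by move=> mz; have := metric_Zl 0 m_real_subspace.1 mz; rewrite scaler0 mul0r.
Qed.

Lemma metric_Nl x z : m x -> m z -> g (- x) z = - g x z.
Proof.
by move=> mx mz; have := metric_Zl (- 1) mx mz; rewrite rmorphN rmorph1 scaleN1r mulN1r.
Qed.

Lemma metric_Zr (r : R) x z : m x -> m z -> g x (r%:C *: z) = r * g x z.
Proof.
move=> mx mz; have mrz := real_subspaceZ r m_real_subspace mz.
by rewrite (metric_sym hg mx mrz) metric_Zl // (metric_sym hg mz mx).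
Qed.

Lemma metric_Nr x z : m x -> m z -> g x (- z) = - g x z.
Proof.
by move=> mx mz; have := metric_Zr (- 1) mx mz; rewrite rmorphN rmorph1 scaleN1r mulN1r.
Qed.

(* The complex bilinear extension of [g] on the pair [X a], [X b]. *)
Definition metric_coef a b : R[i] :=
  ((g (rv a 1) (rv b 1))%:C - (g (rv a 'i) (rv b 'i))%:C
   - 'i * (g (rv a 1) (rv b 'i))%:C - 'i * (g (rv a 'i) (rv b 1))%:C) / 4.

Definition metricC x y : R[i] :=
  \sum_(a <- RM) \sum_(b <- RM) rc a x * rc b y * metric_coef a b.

Lemma metricC_linearl y : scalar (metricC^~ y).
Proof.
move=> t x z; rewrite /metricC mulr_sumr -big_split /=; apply: eq_bigr => a _.
rewrite mulr_sumr -big_split /=; apply: eq_bigr => b _.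
by rewrite rc_linear; ring.
Qed.

Lemma metricC_linearr x : scalar (metricC x).
Proof.
move=> t y z; rewrite /metricC mulr_sumr -big_split /=; apply: eq_bigr => a _.
rewrite mulr_sumr -big_split /=; apply: eq_bigr => b _.
by rewrite rc_linear; ring.
Qed.

Lemma metricC_X a b : a \in RM -> b \in RM -> metricC (X a) (X b) = metric_coef a b.
Proof.
move=> aM bM; have sum1 c (F : root -> R[i]) : c \in RM ->
    \sum_(d <- RM) rc d (X c) * F d = F c.
  move=> cM; rewrite (bigD1_seq c) ?filter_uniq ?hRt.1 //=.
  rewrite rc_X ?RM_root // eqxx mul1r big_seq_cond big1 ?addr0 // => d /andP[dM dc].
  by rewrite rc_X ?RM_root // eq_sym (negPf dc) mul0r.
rewrite /metricC -[RHS](sum1 a (fun c => metric_coef c b)) //.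
apply: eq_bigr => c _; rewrite -(sum1 b (metric_coef c)) // mulr_sumr.
by apply: eq_bigr => d _; rewrite mulrA.
Qed.

Lemma metricC_rv a b s t : a \in RM -> b \in RM ->
  metricC (rv a s) (rv b t) =
    s * t * metric_coef a b - s * t^* * metric_coef a (- b)
    - s^* * t * metric_coef (- a) b + s^* * t^* * metric_coef (- a) (- b).
Proof.
move=> aM bM; have [NaM NbM] := (RM_opp aM, RM_opp bM).
pose Fl y : {scalar L} := HB.pack (metricC^~ y)
  (GRing.isLinear.Build R[i] L R[i] _ (metricC^~ y) (metricC_linearl y)).
pose Fr x : {scalar L} := HB.pack (metricC x)
  (GRing.isLinear.Build R[i] L R[i] _ (metricC x) (metricC_linearr x)).
have Bl p q x y z : metricC (p *: x - q *: y) z = p * metricC x z - q * metricC y z.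
  by have := linearB (Fl z) (p *: x) (q *: y); rewrite !linearZ.
have Br p q x y z : metricC z (p *: x - q *: y) = p * metricC z x - q * metricC z y.
  by have := linearB (Fr z) (p *: x) (q *: y); rewrite !linearZ.
by rewrite /rv Bl !Br !metricC_X //; ring.
Qed.

Lemma metric_coefN a b : a \in RM -> b \in RM ->
  let G := metric_coef in let B s t := (g (rv a s) (rv b t))%:C in
  [/\ G (- a) b = (- B 1 1 - B 'i 'i + 'i * B 1 'i - 'i * B 'i 1) / 4,
      G a (- b) = (- B 1 1 - B 'i 'i - 'i * B 1 'i + 'i * B 'i 1) / 4
    & G (- a) (- b) = (B 1 1 - B 'i 'i + 'i * B 1 'i + 'i * B 'i 1) / 4].
Proof.
move=> aM bM /=; have ma s := m_rv s aM; have mb s := m_rv s bM.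
have mN x : m x -> m (- x) by apply: real_subspaceN m_real_subspace.
rewrite /metric_coef !rvN1 !rvNi.
rewrite !(metric_Nl (ma _) (mb _)) !(metric_Nr (ma _) (mb _)).
rewrite (metric_Nl (ma 1) (mN _ (mb 1))) (metric_Nr (ma 1) (mb 1)) !rmorphN /=.
by split; congr (_ / _); ring.
Qed.

Lemma metricCE_rv a b s t : a \in RM -> b \in RM ->
  s = 1 \/ s = 'i%R -> t = 1 \/ t = 'i%R ->
  (g (rv a s) (rv b t))%:C = metricC (rv a s) (rv b t).
Proof.
move=> aM bM sE tE; rewrite metricC_rv //; have [-> -> ->] := metric_coefN aM bM.
rewrite /metric_coef; have ii : 'i * 'i = -1 :> R[i] by rewrite -expr2 sqrCi.
case: sE tE => -> [] ->; rewrite ?conjC1 ?conjCi.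
- by field.
(* To [field] the unit ['i] is an indeterminate, so the left side receives the factor ['i * 'i] that
   appears on the right. *)
- by rewrite -[LHS]opprK -mulN1r -ii; field.
- by rewrite -[LHS]opprK -mulN1r -ii; field.
by rewrite -[LHS]opprK -mulN1r -ii; field.
Qed.

Lemma metricCE x y : m x -> m y -> (g x y)%:C = metricC x y.
Proof.
have mS := m_real_subspace.
have scalar0 (f : L -> R[i]) : scalar f -> f 0 = 0.
  by move=> fS; have := fS (-1) 0 0; rewrite scaler0 addr0 mulN1r addNr.
suff mV : m `<=` [set x | m x /\ forall y, m y -> (g x y)%:C = metricC x y].
  by move=> /mV[_]; apply.
have closed u : m u -> real_subspace [set y | m y /\ (g u y)%:C = metricC u y].
  move=> mu; have sym v : m v -> g u v = g v u by move=> mv; exact: (metric_sym hg).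
  split=> [|r v w [mv vE] [mw wE]] /=; split.
  - exact: mS.1.
  - by rewrite sym ?metric_0l ?(scalar0 _ (metricC_linearr u)) ?rmorph0 //; exact: mS.1.
  - exact: mS.2.
  rewrite metricC_linearr -vE -wE sym; last exact: mS.2.
  by rewrite (metric_linear hg) // -!sym // rmorphD rmorphM.
apply: m_sub1i => [|a aM|a aM] /=.
- split=> [|r u v [mu uE] [mv vE]] /=; split.
  + exact: mS.1.
  + move=> y' my; rewrite (scalar0 _ (metricC_linearl y')).
    by rewrite metric_0l // rmorph0.
  + exact: mS.2.
  move=> y' my; rewrite metricC_linearl -uE // -vE //.
  by rewrite (metric_linear hg) // rmorphD rmorphM.
- split=> [|y' my]; first exact: m_rv.
  suff: m `<=` [set y | m y /\ (g (rv a 1) y)%:C = metricC (rv a 1) y] by move=> /(_ _ my)[].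
  apply: m_sub1i => [|b bM|b bM] /=; first by apply: closed; exact: m_rv.
    by split; [exact: m_rv | apply: metricCE_rv => //; left].
  by split; [exact: m_rv | apply: metricCE_rv => //; [left | right]].
split=> [|y' my]; first exact: m_rv.
suff: m `<=` [set y | m y /\ (g (rv a 'i) y)%:C = metricC (rv a 'i) y] by move=> /(_ _ my)[].
apply: m_sub1i => [|b bM|b bM] /=; first by apply: closed; exact: m_rv.
  by split; [exact: m_rv | apply: metricCE_rv => //; [right | left]].
by split; [exact: m_rv | apply: metricCE_rv => //; right].
Qed.

(** Up to sign [X (- a)] is the conjugate of [X a], so this coefficient is minus a Hermitian square
    norm. The imaginary terms cancel by symmetry of [g]. *)
Lemma metric_coef_opp a : a \in RM ->
  exists2 u : R, 0 < u & metric_coef (- a) a = - u%:C.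
Proof.
move=> aM; have aR := RM_root aM; have ma s := m_rv s aM.
have a0 : (a == - a) = false.
  apply/negbTE; rewrite -subr_eq0 opprK -mulr2n -scaler_nat scaler_eq0.
  by rewrite pnatr_eq0 (negPf (root_neq0 aR)).
have rv_neq0 s : s != 0 -> rv a s != 0.
  apply: contraNneq => rv0; have : rc a (rv a s) = 0 by rewrite rv0 linear0.
  by rewrite /rv rc_XX // eqxx a0 mulr1 mulr0 subr0 => /eqP.
exists ((g (rv a 1) (rv a 1) + g (rv a 'i) (rv a 'i)) / 4).
  by rewrite divr_gt0 ?ltr0n // addr_gt0 // (metric_pos hg) ?rv_neq0 ?oner_eq0 ?neq0Ci.
have [-> _ _] := metric_coefN aM aM; rewrite (metric_sym hg (ma 'i) (ma 1)).
by rewrite rmorphM rmorphD /= fmorphV rmorph_nat; ring.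
Qed.

(** * Closedness of the Kaehler form on root vectors *)

(** Writing the structure constant through the Killing form, instead of [n a b], makes its symmetry
    in the triple a consequence of invariance. *)
Lemma br_XX a b c : a \in Rt -> b \in Rt -> c \in Rt -> a + b + c = 0 ->
  [br X a, X b] = lie_killing [br X a, X b] (X c) *: X (- c).
Proof.
move=> aR bR cR abc; have ab : a + b = - c by apply/eqP; rewrite -addr_eq0 abc.
rewrite (weyl_br hX) // ab ?oppr_eq0 ?root_neq0 // lie_killingZl.
by have := weyl_killing hX (root_opp cR); rewrite opprK => ->; rewrite mulr1.
Qed.

(** The complex trilinear extension of three times [d_kaehler_form]. *)
Definition d_kaehlerC x y z : R[i] :=
  - metricC (prM [br x, y]) (acs_diag z) + metricC (prM [br x, z]) (acs_diag y)
  - metricC (prM [br y, z]) (acs_diag x).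

Lemma d_kaehlerC_linear x y z :
  [/\ scalar (fun u => d_kaehlerC u y z), scalar (fun u => d_kaehlerC x u z)
    & scalar (fun u => d_kaehlerC x y u)].
Proof.
have DD (p q r p' q' r' t : R[i]) : - (t * p + p') + (t * q + q') - (t * r + r') =
    t * (- p + q - r) + (- p' + q' - r') by ring.
split=> t u v; rewrite /d_kaehlerC.
- by rewrite !lie_brDl acs_diag_linear !prM_linear 2!metricC_linearl metricC_linearr DD.
- rewrite lie_brDl lie_brDr acs_diag_linear !prM_linear 2!metricC_linearl.
  by rewrite metricC_linearr DD.
by rewrite !lie_brDr acs_diag_linear !prM_linear 2!metricC_linearl metricC_linearr DD.
Qed.

Context (hK : almost_kaehler Rt Sigma Theta X g J).

Lemma d_kaehlerC_m x y z : m x -> m y -> m z -> d_kaehlerC x y z = 0.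
Proof.
move=> mx my mz; have mJ u : m u -> m (J u) := acs_m hJ (x := u).
have [mJx mJy mJz] := And3 (mJ _ mx) (mJ _ my) (mJ _ mz).
have [[mxy xyE] [mxz xzE] [myz yzE]] := And3 (prE (m_br mx my)) (prE (m_br mx mz))
  (prE (m_br my mz)).
have := hK mx my mz; rewrite /d_kaehler_form /kaehler_form => /eqP.
rewrite mulf_eq0 invr_eq0 pnatr_eq0 /= => /eqP/(congr1 (real_complex R)).
rewrite rmorph0 !rmorphD !rmorphN /= !metricCE //.
by rewrite /d_kaehlerC xyE xzE yzE !acs_diagE.
Qed.

Lemma d_kaehlerC_X a b c : a \in RM -> b \in RM -> c \in RM ->
  d_kaehlerC (X a) (X b) (X c) = 0.
Proof.
move=> aM bM cM.
have lin x y z := d_kaehlerC_linear x y z.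
apply: (m_scalar_X_eq0 (f := fun x => d_kaehlerC x _ _)) aM => [|x mx].
  (* The argument [0] is a placeholder in the slot where linearity is asserted. *)
  by case: (lin 0 (X b) (X c)) => fS _ _; exact: fS.
apply: (m_scalar_X_eq0 (f := fun y => d_kaehlerC _ y _)) bM => [|y my].
  by case: (lin x 0 (X c)) => _ fS _; exact: fS.
apply: (m_scalar_X_eq0 (f := fun z => d_kaehlerC _ _ z)) cM => [|z mz].
  by case: (lin x y 0) => _ _ fS; exact: fS.
exact: d_kaehlerC_m.
Qed.

(* By invariance of the Killing form the three structure constants of a triple
   of roots with zero sum agree, so closedness of the Kaehler form reads
   [e a * u a + e b * u b + e c * u c = 0]. *)
Lemma acs_eig_triple a b c : a \in RM -> b \in RM -> c \in RM -> a + b + c = 0 ->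
  ~~ ((acs_eig a == acs_eig b) && (acs_eig b == acs_eig c)).
Proof.
move=> aM bM cM abc; have [aR bR cR] := And3 (RM_root aM) (RM_root bM) (RM_root cM).
have ab : a + b = - c by apply/eqP; rewrite -addr_eq0 abc.
have acb : a + c + b = 0 by rewrite addrAC.
have bca : b + c + a = 0 by rewrite addrC addrA.
set N := lie_killing [br X a, X b] (X c).
have Nbc : lie_killing [br X b, X c] (X a) = N by rewrite lie_killingC -lie_killing_br.
have Nac : lie_killing [br X a, X c] (X b) = - N.
  by rewrite lie_killing_br (lie_brC (X c)) linearN /= -lie_killing_br.
have N0 : N != 0.
  apply/eqP => N0; have := br_XX aR bR cR abc; rewrite -/N N0 scale0r.
  rewrite (weyl_br hX) // ab ?oppr_eq0 ?root_neq0 // => /eqP.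
  rewrite scaler_eq0 (negPf (X_neq0 (root_opp cR))) orbF.
  have := weyl_n_neq0 hX aR bR; rewrite ab root_opp // => nab.
  by rewrite -(rmorph0 (real_complex R)) (inj_eq (@complexI _)) (negPf nab).
have [u u0 uE] := metric_coef_opp aM; have [v v0 vE] := metric_coef_opp bM.
have [w w0 wE] := metric_coef_opp cM.
have MZ s t x y : metricC (s *: x) (t *: y) = s * t * metricC x y.
  have M0l z : metricC 0 z = 0.
    by have := metricC_linearl z (-1) 0 0; rewrite scaler0 addr0 mulN1r addNr.
  have M0r z : metricC z 0 = 0.
    by have := metricC_linearr z (-1) 0 0; rewrite scaler0 addr0 mulN1r addNr.
  rewrite -[s *: x]addr0 -[t *: y]addr0 metricC_linearl metricC_linearr.
  by rewrite M0l M0r !addr0 mulrA.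
have prX d : d \in RM -> prM (X (- d)) = X (- d).
  by move=> dM; rewrite /prM diag_X ?RM_opp // scale1r.
have prZ t x : prM (t *: x) = t *: prM x by exact: diagZ.
have := d_kaehlerC_X aM bM cM; rewrite /d_kaehlerC.
(* The sign in [Nac] offsets that of the middle term of the differential, so the three contributions
   enter with the same sign. Only pairings of opposite root vectors occur. *)
rewrite (br_XX aR bR cR abc) (br_XX aR cR bR acb) (br_XX bR cR aR bca) Nac Nbc -/N.
rewrite !prZ !prX // /acs_diag !diag_X // !MZ !metricC_X ?RM_opp // uE vE wE => E.
apply/negP => /andP[/eqP eab /eqP ebc]; move: E; rewrite eab ebc => E.
have : N * acs_eig c * (u + v + w)%:C = 0 by rewrite -E !rmorphD /=; ring.
move=> /eqP; rewrite !mulf_eq0 (negPf N0) -(rmorph0 (real_complex R)) (inj_eq (@complexI _)).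
rewrite (gt_eqF (addr_gt0 (addr_gt0 u0 v0) w0)) orbF /= rmorph0 -[_ == 0]sqrf_eq0.
by rewrite acs_eig_sqr // oppr_eq0 oner_eq0.
Qed.

(** * The Nijenhuis tensor on root vectors *)

(** The complex bilinear extension of minus one half of [nijenhuis]. *)
Definition nijenhuisC x y : L :=
  - prM [br acs_diag x, acs_diag y] + prM [br x, y]
  + acs_diag (prM [br x, acs_diag y]) + acs_diag (prM [br acs_diag x, y]).

Lemma nijenhuisC_linear x y :
  linear (fun u => nijenhuisC u y) /\ linear (fun u => nijenhuisC x u).
Proof.
have DD (p q r s p' q' r' s' : L) t :
    - (t *: p + p') + (t *: q + q') + (t *: r + r') + (t *: s + s') =
    t *: (- p + q + r + s) + (- p' + q' + r' + s').
  rewrite !scalerDr scalerN opprD [X in X + _ + _ = _]addrACA [X in X + _ = _]addrACA.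
  exact: addrACA.
by split=> t u v; rewrite /nijenhuisC !acs_diag_linear ?lie_brDl ?lie_brDr
  !prM_linear ?acs_diag_linear DD.
Qed.

Lemma nijenhuisC_X a b : a \in RM -> b \in RM -> nijenhuisC (X a) (X b) = 0.
Proof.
move=> aM bM; have [aR bR] := (RM_root aM, RM_root bM).
have prZ t x : prM (t *: x) = t *: prM x by exact: diagZ.
have acsZ t x : acs_diag (t *: x) = t *: acs_diag x by exact: diagZ.
have acsX d : d \in RM -> acs_diag (X d) = acs_eig d *: X d by exact: diag_X.
rewrite /nijenhuisC !acsX // !lie_brZl !lie_brZr !prZ !acsZ.
(* All four terms are now built from the same projected bracket, which vanishes unless [a + b] is a
   root in R_M. *)
suff [->|[c cM [abc ->]]] : prM [br X a, X b] = 0 \/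
    exists2 c, c \in RM & a + b + c = 0 /\
      prM [br X a, X b] = (n a b)%:C *: X (- c).
- have acs0 : acs_diag 0 = 0 by have := acsZ 0 0; rewrite !scale0r.
  by rewrite acs0 !scaler0 oppr0 !addr0.
- have NcM := RM_opp cM; rewrite acsZ acsX // acs_eig_opp // !scalerA.
  rewrite -scaleNr -!scalerDl; set z := (X in X *: _); suff -> : z = 0 by rewrite scale0r.
  have ea := acs_eig_sqr aM; have eb := acs_eig_sqr bM; have ec := acs_eig_sqr cM.
  have := acs_eig_triple aM bM cM abc; rewrite /z {z}.
  (* The scalar is [n a b] times [1 - p q - q r - p r]. For square roots of -1 the second factor
     vanishes as soon as two of them are opposite, and equals 4 if all three agree. *)
  move: (acs_eig a) (acs_eig b) (acs_eig c) ea eb ec => p q r pp qq rr.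
  have [->|pq] /= := eqVneq p q.
    have : (q == r) || (q == - r) by rewrite -eqf_sqr qq rr.
    case: eqVneq => //= qr /eqP -> _.
    by transitivity ((n a b)%:C * (r ^+ 2 + 1)); [ring | rewrite rr addNr mulr0].
  have : (p == q) || (p == - q) by rewrite -eqf_sqr pp qq.
  rewrite (negPf pq) /= => /eqP -> _.
  transitivity ((n a b)%:C * (q ^+ 2 + 1)); first by ring.
  by rewrite qq addNr mulr0.
have [ab|ab] := eqVneq (a + b) 0.
  left; have -> : b = - a by apply/eqP; rewrite -addr_eq0 addrC ab.
  by rewrite /prM diag_h //; exact: Hr_h.
rewrite (weyl_br hX) // prZ; have [abR|abR] := boolP (a + b \in Rt); last first.
  left; have := weyl_n_neq0 hX aR bR; rewrite (negPf abR) => /negbFE/eqP ->.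
  by rewrite scale0r.
have [abM|abM] := boolP (a + b \in RM); last first.
  by left; rewrite /prM diag_notin // scaler0.
right; exists (- (a + b)); first exact: RM_opp.
by rewrite subrr opprK /prM diag_X // scale1r.
Qed.

Lemma nijenhuisC_m x y : m x -> m y -> nijenhuisC x y = 0.
Proof.
have lin u v := nijenhuisC_linear u v.
move=> mx my; apply: (m_linear_eq0 (f := fun x => nijenhuisC x y)) mx => [|a aM].
  by case: (lin 0 y) => fL _; exact: fL.
apply: (m_linear_eq0 (f := fun y => nijenhuisC _ y)) my => [|b bM].
  by case: (lin (X a) 0) => _ fL; exact: fL.
exact: nijenhuisC_X.
Qed.

Lemma almost_kaehler_integrable : integrable Rt Sigma Theta X J.
Proof.
move=> x y mx my; have mJ u : m u -> m (J u) := acs_m hJ (x := u).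
have [_ E1] := prE (m_br (mJ _ mx) (mJ _ my)); have [_ E2] := prE (m_br mx my).
have [m3 E3] := prE (m_br mx (mJ _ my)); have [m4 E4] := prE (m_br (mJ _ mx) my).
rewrite /nijenhuis (acs_diagE m3) (acs_diagE m4) E1 E2 E3 E4 !acs_diagE //.
by have := nijenhuisC_m mx my; rewrite /nijenhuisC => ->; rewrite mul0rn oppr0.
Qed.

End AlmostHermitian.

End AlmostComplex.

End WeylBasis.

Theorem proposition6p7 (R : realType) (L : lieAlgType R[i])
    (hL : lie_semisimple L)
    (h : {vspace L}) (hh : cartan_subalgebra h)
    (Rt Sigma Theta : seq 'Hom(subvs_of h, R[i]^o))
    (hRt : root_system Rt) (hSigma : simple_system Rt Sigma)
    (hTheta : {subset Theta <= Sigma})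
    (X : 'Hom(subvs_of h, R[i]^o) -> L)
    (n : 'Hom(subvs_of h, R[i]^o) -> 'Hom(subvs_of h, R[i]^o) -> R)
    (hX : weyl_basis Rt X n)
    (g : L -> L -> R) (J : L -> L)
    (hgJ : invariant_almost_hermitian Rt Sigma Theta X g J) :
  almost_kaehler Rt Sigma Theta X g J <-> kaehler Rt Sigma Theta X g J.
Proof.
split=> [hK|[]//]; split=> //; case: hgJ => hg hJ.
exact: (almost_kaehler_integrable hL hh hRt hX hSigma hJ hg hK).
Qed.
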